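(* Let $\alpha:\{1,2,3,\ldots\}\to(0,\infty)$ be a fixed non-decreasing function, let $(b_n)_{n\ge 1}$ be any sequence of positive integers tending to infinity, and let $\phi_n^*$, $n\ge1$, be the histogram-based density estimates determined by $\alpha$ and $(b_n)$ as defined in the context. For every stationary ergodic real-valued process $\{X_i\}$ such that the common distribution of the $X_i$ has a density $f\in\mathcal{F}(\alpha)$, $$\int_{\mathbb{R}}|\phi_n^*(x:X_1,\ldots,X_n)-f(x)|\,dx\to0$$ as $n\to\infty$ with probability one.
   Context: A density is a function $f:\mathbb{R}\to\mathbb{R}$ that is measurable, nonnegative and has $\int_{\mathbb{R}} f\,dx=1$. Here the process $\{X_i\}$ is stationary and ergodic in the usual probabilistic sense, and the $X_i$ having density $f$ means $\mathbb{P}\{X_i\in A\}=\int_A f\,dx$ for every Borel set $A\subseteq\mathbb{R}$. Variation: for a real-valued function $h$ on $[a,b)$, $V(h:a,b)=\sup\sum_{i=1}^n|h(t_i)-h(t_{i-1})|$, the supremum being over all finite sequences $a\le t_0<\cdots<t_n<b$. For non-decreasing $\alpha:\{1,2,\ldots\}\to(0,\infty)$, $\mathcal{F}(\alpha)$ is the set of all densities $f$ on $\mathbb{R}$ with $V(f:-i,i)<\alpha(i)$ for all integers $i\ge1$. The estimates $\phi_n^*$: for $k\ge1$ let $\pi_k$ be the partition of $\mathbb{R}$ into the dyadic intervals $A_{k,j}=[j2^{-k},(j+1)2^{-k})$, $j\in\mathbb{Z}$, and let $\pi_k[x]$ be the cell of $\pi_k$ containing $x$. Given real numbers $x_1,\ldots,x_n$,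 define $$\hat h_{n,k}(x)=\frac{2^k}{n}\sum_{i=1}^n I\{x_i\in\pi_k[x]\},$$ $$k_n=\max\{1\le k\le b_n:\ V(\hat h_{n,k}:-i,i)<4\alpha(i)\ \text{for } 1\le i\le k\},$$ and $\phi_n^*(x:x_1,\ldots,x_n)=\hat h_{n,k_n}(x)$. If no $k$ with $1\le k\le b_n$ satisfies the condition defining $k_n$, then $\phi_n^*\equiv0$. *)

(* Defs.v *)
From mathcomp Require Import all_boot all_order all_algebra.
From mathcomp Require Import all_classical all_reals all_analysis.

Set Implicit Arguments.
Unset Strict Implicit.
Unset Printing Implicit Defensive.

Import Order.TTheory GRing.Theory Num.Theory.
Import numFieldNormedType.Exports.

Local Open Scope classical_set_scope.
Local Open Scope ring_scope.

Definition is_density (R : realType) (f : R -> R) : Prop :=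
  [/\ measurable_fun [set: R] f, (forall x, 0 <= f x) &
      (\int[lebesgue_measure]_x (f x)%:E = 1)%E].

(* Variation over the half-open interval [a, b[ : the sequences
   a <= t_0 < ... < t_n < b are encoded by c = t_0, s = [:: t_1; ...; t_n] and
   d = t_n. In contrast, the library's total_variation concerns [a, b]. *)
Definition variation_co (R : realType) (h : R -> R) (a b : R) : \bar R :=
  ereal_sup [set v | exists c d s,
    [/\ a <= c, itv_partition c d s, d < b & v = (variation c d h s)%:E]].

(* Only the values alpha i with 1 <= i are relevant. *)
Definition densities_of_variation (R : realType) (alpha : nat -> R) :
    set (R -> R) :=
  [set f | is_density f /\ forall i : nat, (1 <= i)%N ->
    (variation_co f (- i%:R) i%:R < (alpha i)%:E)%E].

Definition dyadic_cell (R : realType) (k : nat) (j : int) : set R :=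
  `[j%:~R * 2 ^- k, (j + 1)%:~R * 2 ^- k[%classic.

(* The union has exactly one member, the dyadic cell of level k containing x. *)
Definition dyadic_cell_at (R : realType) (k : nat) (x : R) : set R :=
  \bigcup_(j in [set j | dyadic_cell k j x]) dyadic_cell k j.

Definition histogram (R : realType) (n k : nat) (xs : 'I_n -> R) (x : R) : R :=
  2 ^+ k / n%:R * \sum_(i < n) \1_(dyadic_cell_at k x) (xs i).

Definition admissible_level (R : realType) (alpha : nat -> R) (n : nat)
    (xs : 'I_n -> R) (k : nat) : Prop :=
  forall i : nat, (1 <= i <= k)%N ->
    (variation_co (histogram k xs) (- i%:R) i%:R < (4 * alpha i)%:E)%E.

(* Equal to 0 exactly when no level in [1, b] is admissible. *)
Definition histogram_level (R : realType) (alpha : nat -> R) (b n : nat)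
    (xs : 'I_n -> R) : nat :=
  (\max_(1 <= k < b.+1 | `[< admissible_level alpha xs k >]) k)%N.

Definition density_estimate (R : realType) (alpha : nat -> R) (b n : nat)
    (xs : 'I_n -> R) (x : R) : R :=
  let k := histogram_level alpha b xs in
  if k == 0%N then 0 else histogram k xs x.

(* The product sigma-algebra on real sequences. *)
Definition sequence_measurable (R : realType) : set (set (nat -> R)) :=
  <<s [set A | exists (i : nat) (B : set R),
         measurable B /\ A = (fun u : nat -> R => u i) @^-1` B] >>.

Definition sequence_shift (R : realType) (u : nat -> R) : nat -> R :=
  fun i => u i.+1.

Definition path_preimage (R : realType) (d : measure_display)
    (T : measurableType d) (P : probability T R) (X : nat -> {RV P >-> R})
    (A : set (nat -> R)) : set T :=
  [set w | A (fun i => X i w)].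

Definition stationary (R : realType) (d : measure_display)
    (T : measurableType d) (P : probability T R) (X : nat -> {RV P >-> R}) :
    Prop :=
  forall A, sequence_measurable A ->
    P (path_preimage X (@sequence_shift R @^-1` A)) = P (path_preimage X A).

Definition ergodic (R : realType) (d : measure_display)
    (T : measurableType d) (P : probability T R) (X : nat -> {RV P >-> R}) :
    Prop :=
  forall A, sequence_measurable A -> @sequence_shift R @^-1` A = A ->
    P (path_preimage X A) = 0%E \/ P (path_preimage X A) = 1%E.

Definition has_density (R : realType) (d : measure_display)
    (T : measurableType d) (P : probability T R) (Y : {RV P >-> R})
    (f : R -> R) : Prop :=
  forall A : set R, measurable A ->
    (distribution P Y A = \int[lebesgue_measure]_(x in A) (f x)%:E)%E.

(* Main.v *)
(* The empirical frequencies of all dyadic cells converge almost surely; the rest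
   of the argument is deterministic. The ergodic theorem is only needed for
   indicator functions, where stopping blocks of frequency at least q tile an
   initial segment greedily and stationarity bounds q by the probability.

   For a fixed level k the histogram converges on each cell to the average of f,
   and averaging at most doubles the variation; since 2 < 4, level k is
   eventually admissible, and therefore k_n tends to infinity. Conversely, for a
   fixed level m <= k_n, the estimate and f differ on a cell of level m by at most
   their difference in mean plus their oscillations. The oscillations sum up to
   the variations, which are bounded by 4 alpha i and alpha i on [-i, i[, so they
   contribute at most 2^-m * 5 alpha i to the L1 distance, while the differences
   in mean tend to 0. The complement of [-i, i[ is handled by Scheffe's argument,
   as both functions are densities. *)

Require Import Defs.
From mathcomp Require Import all_boot all_order all_algebra.
From mathcomp Require Import all_classical all_reals all_analysis.
From mathcomp Require Import measurable_realfun.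
From mathcomp Require Import ring lra.

Set Implicit Arguments.
Unset Strict Implicit.
Unset Printing Implicit Defensive.

Import Order.TTheory GRing.Theory Num.Theory.
Import numFieldNormedType.Exports.

Local Open Scope classical_set_scope.
Local Open Scope ring_scope.

(** * Visit frequencies of ergodic processes *)

Section visits.
Context (R : realType).
Implicit Types (B : set R) (u : nat -> R).

Local Notation shift := (@sequence_shift R).

Definition visits B u (n : nat) : R := \sum_(i < n) \1_B (u i).

Lemma iter_shiftE i u j : iter i shift u j = u (i + j)%N.
Proof. by elim: i j => //= i IH j; rewrite /sequence_shift IH addSnnS. Qed.

Lemma visitsD B u m n : visits B u (m + n) = visits B u m + visits B (iter m shift u) n.
Proof.
rewrite /visits big_split_ord /=; congr (_ + _).
by apply: eq_bigr => i _; rewrite iter_shiftE.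
Qed.

Lemma visitsS B u n : visits B u n.+1 = \1_B (u 0%N) + visits B (shift u) n.
Proof. by rewrite -add1n visitsD /visits big_ord1. Qed.

Lemma visits_ge0 B u n : 0 <= visits B u n.
Proof. exact: sumr_ge0. Qed.

Lemma visits_setC B u n : visits (~` B) u n = n%:R - visits B u n.
Proof.
apply/eqP; rewrite eq_sym subr_eq /visits -big_split /=.
rewrite (eq_bigr (fun=> 1)) ?sumr_const ?card_ord// => i _.
by rewrite !indicE in_setC; case: (_ \in _); rewrite ?addr0 ?add0r.
Qed.

(** Whether a good block starts at a given time depends on the whole future of the path, so times
    are classified by a set of paths rather than of reals. *)
Definition orbit_visits (D : set (nat -> R)) u (n : nat) : R :=
  \sum_(i < n) \1_D (iter i shift u).

Lemma orbit_visitsD D u m n :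
  orbit_visits D u (m + n) = orbit_visits D u m + orbit_visits D (iter m shift u) n.
Proof.
rewrite /orbit_visits big_split_ord /=; congr (_ + _).
by apply: eq_bigr => i _; rewrite addnC iterD.
Qed.

Lemma orbit_visits_ge0 D u n : 0 <= orbit_visits D u n.
Proof. exact: sumr_ge0. Qed.

(* Greedy tiling of [0, L[: from a time where the path is in D, jump over a
   block of length at most N with visit frequency at least q; otherwise advance
   by one step. *)
Lemma visits_tiling (q : R) (N : nat) B (D : set (nat -> R)) (q0 : 0 <= q) :
  (forall u, D u -> exists n, (0 < n <= N)%N /\ q * n%:R <= visits B u n) ->
  forall L u, q * L%:R <= q * N%:R + (visits B u L + q * orbit_visits (~` D) u L).
Proof.
move=> DN L; elim/ltn_ind: L => L IH u.
(* The last stretch may be too short for a block; the term [q * N%:R] pays for it. *)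
have [LN|NL] := leqP L N.
  rewrite -[leLHS]addr0 lerD ?ler_wpM2l ?ler_nat//.
  by rewrite addr_ge0 ?visits_ge0 ?mulr_ge0 ?orbit_visits_ge0.
have [Du|nDu] := pselect (D u).
  have [n [/andP[n0 nN] qn]] := DN _ Du.
  have nL : (n <= L)%N by rewrite (leq_trans nN)// ltnW.
  have := subnKC nL; move: (L - n)%N => m Lnm; rewrite -Lnm in IH *.
  have /IH/(_ (iter n shift u)) : (m < n + m)%N by rewrite -addn1 addnC leq_add2r.
  rewrite visitsD orbit_visitsD natrD.
  have := mulr_ge0 q0 (orbit_visits_ge0 (~` D) u n).
  rewrite !mulrDr; lra.
case: L NL IH => [|L] // NL /(_ L (ltnSn L) (shift u)).
rewrite visitsS -add1n orbit_visitsD natrD.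
have -> : orbit_visits (~` D) u 1 = 1 by rewrite /orbit_visits big_ord1 indicE mem_set.
rewrite !mulrDr !mulr1 /=.
have : 0 <= \1_B (u 0%N) :> R by [].
lra.
Qed.

End visits.

(** * Measurability of path events *)

Section path_measurability.
Context (R : realType).

Local Notation shift := (@sequence_shift R).

(** Naming the generators makes sequences a measurable type whose measurable sets are
    [sequence_measurable] by conversion. *)
Definition cylinders : set (set (nat -> R)) :=
  [set A | exists (i : nat) (B : set R),
         measurable B /\ A = (fun u : nat -> R => u i) @^-1` B].

Local Notation path_space := (g_sigma_algebraType cylinders).

Lemma measurable_coordinate i :
  measurable_fun [set: path_space] (fun u : path_space => (u : nat -> R) i).
Proof.
move=> _ B mB; rewrite setTI; apply: sub_sigma_algebra.
by exists i, B.
Qed.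

Lemma measurable_visits B n : measurable B ->
  measurable_fun [set: path_space] (fun u : path_space => visits B u n).
Proof.
move=> mB; apply: measurable_sum => i.
apply: measurableT_comp; first exact: measurable_indic.
exact: measurable_coordinate.
Qed.

Lemma measurable_iter_shift i :
  measurable_fun [set: path_space] (iter i shift : path_space -> path_space).
Proof.
apply: (@measurability _ _ path_space path_space _ _ cylinders) => //.
move=> _ [_ [j [B [mB ->]] <-]].
have := measurable_coordinate (i + j) measurableT mB.
rewrite !setTI; congr measurable.
by apply/seteqP; split=> u /=; rewrite iter_shiftE.
Qed.

Context d (T : measurableType d) (P : probability T R) (X : nat -> {RV P >-> R}).

Lemma measurable_path :
  measurable_fun [set: T] ((fun w i => X i w) : T -> path_space).
Proof.
apply: (@measurability _ _ T path_space _ _ cylinders) => //.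
move=> _ [_ [j [B [mB ->]] <-]].
rewrite setTI; apply: measurable_funPTI => //.
Qed.

Lemma measurable_path_preimage (A : set path_space) : measurable A ->
  measurable (path_preimage X A).
Proof.
by move=> mA; have := measurable_path measurableT mA; rewrite setTI.
Qed.

Lemma stationary_iter (A : set path_space) i : stationary X -> measurable A ->
  P (path_preimage X (iter i shift @^-1` A)) = P (path_preimage X A).
Proof.
move=> statX mA; elim: i => [|i <-]; first by [].
rewrite -(statX (iter i shift @^-1` A)).
  by congr (P (path_preimage _ _)); apply/funext => u /=; rewrite -iterSr.
by have := measurable_iter_shift i measurableT mA; rewrite setTI.
Qed.

End path_measurability.
(** Otherwise [(a - b) * n%:R] would outgrow c. This removes the boundary term of the tiling
    inequality. *)
Lemma le_of_natmul_le (R : archiRealFieldType) (a b c : R) :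
  (forall n : nat, a * n%:R <= c + b * n%:R) -> a <= b.
Proof.
move=> H; rewrite leNgt; apply/negP => ba.
have := H (Num.bound (c / (a - b))); apply/negP; rewrite -ltNge -ltrBrDr -mulrBl.
rewrite mulrC -ltr_pdivrMr ?subr_gt0//.
have := H 0%N; rewrite !mulr0 addr0 => c0.
by rewrite archi_boundP// divr_ge0// subr_ge0 ltW.
Qed.

(** * Almost sure limits of visit frequencies *)

Section frequency.
Context (R : realType) d (T : measurableType d) (P : probability T R)
  (X : nat -> {RV P >-> R}).
Hypotheses (X_stationary : stationary X) (X_ergodic : ergodic X).

Local Notation shift := (@sequence_shift R).
Local Notation path_space := (g_sigma_algebraType (@cylinders R)).
Local Notation path w := (fun i => X i w).

Let measurable_ge (B : set R) (c : R) n : measurable B ->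
  measurable ([set u | c <= visits B u n] : set path_space).
Proof.
move=> mB; rewrite -[X in measurable X]setTI.
by apply: measurable_fun_le => //; exact: measurable_visits.
Qed.

(* sup_n (S_n - q n) = +oo, an event that is exactly shift-invariant, unlike
   {S_n >= q n infinitely often}. *)
Let escape (B : set R) (q : R) : set path_space :=
  \bigcap_(C : nat) \bigcup_(n : nat) [set u | q * n%:R + C%:R <= visits B u n].

Let measurable_escape B q : measurable B -> measurable (escape B q).
Proof.
move=> mB; apply: bigcapT_measurable => C; apply: bigcupT_measurable => n.
exact: measurable_ge.
Qed.

(** A shift changes the number of visits by at most 1 and [q * n%:R] by q; a larger constant C
    absorbs both. *)
Let escape_invariant B q : 0 <= q -> shift @^-1` (escape B q) = escape B q.
Proof.
move=> q0; apply/seteqP; split=> u /= uq C _.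
- have [n _ /= +] := uq (C + Num.bound q)%N I => un; exists n.+1 => //=.
  move: un; rewrite visitsS -natr1 mulrDr mulr1.
  have : 0 <= \1_B (u 0%N) :> R by [].
  have := archi_boundP q0; rewrite natrD; lra.
- have [[|n] _ /= un] := uq C.+1 I.
    by move: un; rewrite /visits big_ord0 mulr0 add0r lern0.
  exists n => //=; move: un; rewrite visitsS -!natr1 mulrDr mulr1.
  have : \1_B (u 0%N) <= 1 :> R by rewrite indicE lern1 leq_b1.
  lra.
Qed.

Let mean_visits B n : measurable B ->
  (\int[P]_w (visits B (path w) n)%:E = (n%:R * fine (P (X 0%N @^-1` B)))%:E)%E.
Proof.
move=> mB.
have mX i : measurable (X i @^-1` B) by exact: measurable_funPTI.
transitivity (\int[P]_w \sum_(i < n) (\1_(X i @^-1` B) w)%:E)%E.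
  by apply: eq_integral => w _; rewrite -sumEFin.
rewrite ge0_integral_sum//; last first.
  by move=> i; apply/measurable_EFinP; exact: measurable_indic.
rewrite (eq_bigr (fun=> (fine (P (X 0%N @^-1` B)))%:E)).
  by rewrite sumEFin sumr_const card_ord mulr_natl.
move=> i _; rewrite integral_indic// setIT fineK ?fin_num_measure//.
pose A : set path_space := (fun u => u 0%N) @^-1` B.
have mA : measurable A.
  by have := measurable_coordinate (R := R) 0 measurableT mB; rewrite setTI.
rewrite -[RHS](stationary_iter i X_stationary mA).
by congr (P _); apply/seteqP; split=> w; rewrite /A /path_preimage /preimage /= iter_shiftE addn0.
Qed.

Let mean_orbit_visits (D : set path_space) n : measurable D ->
  (\int[P]_w (orbit_visits D (path w) n)%:E = (n%:R * fine (P (path_preimage X D)))%:E)%E.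
Proof.
move=> mD.
have mSD i : measurable (iter i shift @^-1` D : set path_space).
  by have := measurable_iter_shift i measurableT mD; rewrite setTI.
transitivity (\int[P]_w \sum_(i < n) (\1_(path_preimage X (iter i shift @^-1` D)) w)%:E)%E.
  by apply: eq_integral => w _; rewrite -sumEFin.
rewrite ge0_integral_sum//; last first.
  move=> i; apply/measurable_EFinP; apply: measurable_indic.
  exact: measurable_path_preimage.
rewrite (eq_bigr (fun=> (fine (P (path_preimage X D)))%:E)).
  by rewrite sumEFin sumr_const card_ord mulr_natl.
move=> i _; rewrite integral_indic//; last exact: measurable_path_preimage.
rewrite setIT fineK ?fin_num_measure//; last exact: measurable_path_preimage.
exact: stationary_iter.
Qed.

Let measurable_visits_path B n : measurable B ->
  measurable_fun [set: T] (fun w => visits B (path w) n).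
Proof.
move=> mB.
exact: (measurableT_comp (measurable_visits n mB) (measurable_path X)).
Qed.

Let measurable_orbit_visits_path (D : set path_space) n : measurable D ->
  measurable_fun [set: T] (fun w => orbit_visits D (path w) n).
Proof.
move=> mD; apply: measurable_sum => i.
have mg : measurable_fun [set: path_space]
      (\1_D \o (iter i shift : path_space -> path_space) : path_space -> R).
  apply: measurableT_comp; first exact: measurable_indic.
  exact: measurable_iter_shift.
exact: (measurableT_comp mg (measurable_path X)).
Qed.

(** By ergodicity [escape B q] has probability 0 or 1, and 0 gives the claim. If it were 1, almost
    every path would begin with a block of visit frequency at least q; tiling by such blocks of
    length at most N forces q to be at most p, up to a multiple of the probability that no such
    block exists, which vanishes as N grows. *)
Lemma visits_le (B : set R) (q : R) : measurable B ->
  fine (P (X 0%N @^-1` B)) < q ->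
  {ae P, forall w, exists C : nat, forall n, visits B (path w) n <= q * n%:R + C%:R}.
Proof.
move=> mB pq; set p := fine _ in pq *.
have p0 : 0 <= p by rewrite /p fine_ge0.
have q0 : 0 <= q by rewrite (le_trans p0)// ltW.
have mE := measurable_escape q mB.
have := X_ergodic mE (escape_invariant B q0); case => [E0|E1].
  exists (path_preimage X (escape B q)); split => //.
    exact: measurable_path_preimage.
  move=> w /= nw; rewrite /path_preimage /escape /= => C _.
  apply: contrapT => Cw; apply: nw; exists C => n; rewrite leNgt; apply/negP => /ltW nC.
  by apply: Cw; exists n.
exfalso.
pose D N : set path_space := \bigcup_(n in [set n | (0 < n <= N)%N])
  [set u | q * n%:R <= visits B u n].
have mD N : measurable (D N).
  by apply: bigcup_measurable => n _; exact: measurable_ge.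
have mnD N : measurable (~` D N) by exact: measurableC.
pose F N := path_preimage X (~` D N).
have mF N : measurable (F N) by exact: measurable_path_preimage.
have mFF : measurable (\bigcap_N F N) by exact: bigcapT_measurable.
have F0 : P (\bigcap_N F N) = 0%E.
  apply/eqP; rewrite eq_le measure_ge0 andbT.
  have mE' := measurable_path_preimage X mE.
  have <- : P (~` path_preimage X (escape B q)) = 0%E by rewrite probability_setC// E1 subee.
  apply: le_measure; rewrite ?inE//; first exact: measurableC.
  (* The constant 1 forces the block to be nonempty. *)
  move=> w Fw Ew; have [[|n] _ /= nw] := Ew 1%N I.
    by move: nw; rewrite /visits big_ord0 mulr0 add0r lern0.
  apply: (Fw n.+1 I); exists n.+1; rewrite /= ?leqnn//.
  by move: nw; lra.
have cvgF : (P \o F) N @[N --> \oo] --> 0%E.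
  rewrite -F0; apply: nonincreasing_cvg_mu => //.
    by rewrite (le_lt_trans (probability_le1 _ _)) ?ltry.
  move=> m n mn; apply/subsetPset => w nF [k /= /andP[k0 km] kw]; apply: nF.
  by exists k => //=; rewrite k0 (leq_trans km).
(* The expectation of the tiling inequality over L steps, divided by L as L grows; stationarity
   makes both expected counts linear in L. *)
have qF N : q <= p + q * fine (P (F N)).
  apply: (@le_of_natmul_le _ _ _ (q * N%:R)) => L.
  rewrite -lee_fin -[leLHS]mule1 -(probability_setT P) -integral_cst//.
  have -> : ((q * N%:R + (p + q * fine (P (F N))) * L%:R)%:E =
     \int[P]_w ((q * N%:R)%:E + ((visits B (path w) L)%:E +
       q%:E * (orbit_visits (~` D N) (path w) L)%:E)))%E.
    have mV := measurable_visits_path L mB.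
    have mO := measurable_orbit_visits_path L (mnD N).
    have mqO : measurable_fun [set: T] (fun w => q%:E * (orbit_visits (~` D N) (path w) L)%:E)%E.
      by apply/measurable_EFinP; apply: measurable_funM.
    have qO0 w : (0 <= q%:E * (orbit_visits (~` D N) (path w) L)%:E)%E.
      by rewrite lee_fin mulr_ge0// orbit_visits_ge0.
    rewrite ge0_integralD//; last 3 first.
    - by move=> w _; rewrite lee_fin mulr_ge0.
    - by move=> w _; rewrite adde_ge0// lee_fin visits_ge0.
    - by apply: emeasurable_funD => //; apply/measurable_EFinP.
    rewrite ge0_integralD//; last 2 first.
    - by move=> w _; rewrite lee_fin visits_ge0.
    - by apply/measurable_EFinP.
    rewrite ge0_integralZl//; last 2 first.
    - by apply/measurable_EFinP.
    - by move=> w _; rewrite lee_fin orbit_visits_ge0.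
    rewrite mean_visits// mean_orbit_visits// integral_cst//.
    rewrite [X in (_ * X + _)%E]probability_setT mule1.
    rewrite -!EFinM -!EFinD; congr (_ %:E); rewrite -/(F N) -/p; ring.
  apply: ge0_le_integral => //.
  - by move=> w _; rewrite lee_fin mulr_ge0.
  - apply/measurable_EFinP/measurable_funD => //; apply: measurable_funD.
      exact: measurable_visits_path.
    by apply: measurable_funM => //; exact: measurable_orbit_visits_path.
  - move=> w _; rewrite -EFinM -!EFinD lee_fin; apply: visits_tiling => // u [n /= nN un].
    by exists n.
(* A probability of [F N] below this threshold makes [q * fine (P (F N))] smaller than [q - p],
   against [qF]. *)
have /fine_cvgP[_ /cvgrPdist_lt/(_ ((q - p) / (q + 1)))] := cvgF.
have e0 : 0 < (q - p) / (q + 1) by rewrite divr_gt0 ?subr_gt0 ?ltr_wpDl.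
move=> /(_ e0) [N _ /(_ N (leqnn N))] /=.
have x0 : 0 <= fine (P (F N)) by rewrite fine_ge0.
rewrite sub0r normrN ger0_norm// => xlt.
have {xlt} : fine (P (F N)) < (q - p) / (q + 1) := xlt.
rewrite ltr_pdivlMr; last by rewrite ltr_wpDl.
have := qF N.
move: x0; move: (fine _) => x; lra.
Qed.

(** The lower bound is the upper bound [visits_le] for the complement of B. Thresholds exceeding the
    probability by 1/(k+1) keep the exceptional sets countable in number. *)
Lemma visit_frequency_cvg (B : set R) : measurable B ->
  {ae P, forall w, visits B (path w) n / n%:R @[n --> \oo] --> fine (P (X 0%N @^-1` B))}.
Proof.
move=> mB.
have mnB : measurable (~` B) by exact: measurableC.
have mX : measurable (X 0%N @^-1` B) by exact: measurable_funPTI.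
have pC : fine (P (X 0%N @^-1` (~` B))) = 1 - fine (P (X 0%N @^-1` B)).
  by rewrite preimage_setC probability_setC// fineB ?fin_num_measure.
set p := fine (P (X 0%N @^-1` B)) in pC *.
have e0 k : 0 < k.+1%:R^-1 :> R by rewrite invr_gt0.
have [U V] : {ae P, forall w, forall k, exists C : nat, forall n,
    visits B (path w) n <= (p + k.+1%:R^-1) * n%:R + C%:R} /\
  {ae P, forall w, forall k, exists C : nat, forall n,
    visits (~` B) (path w) n <= (1 - p + k.+1%:R^-1) * n%:R + C%:R}.
  split; apply: ae_foralln => k; apply: visits_le => //.
    by rewrite ltrDl.
  by rewrite pC ltrDl.
move: U V; apply: filterS2 => w U V.
apply/cvgrPdist_le => e eps0.
(* One half of e covers the excess of the threshold, the other the additive constants once n is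
   large. *)
have [k ke] : exists k, k.+1%:R^-1 <= e / 2.
  exists (Num.bound (e / 2)^-1); rewrite -[leRHS]invrK lef_pV2 ?posrE ?invr_gt0 ?divr_gt0//.
  have : 0 <= (e / 2)^-1 by rewrite invr_ge0 divr_ge0// ltW.
  by move=> /archi_boundP/ltW/le_trans; apply; rewrite ler_nat.
have [C1 U1] := U k; have [C2 V1] := V k.
near=> n.
have n0 : 0 < n%:R :> R by rewrite ltr0n; near: n; exact: nbhs_infty_gt.
have Cn : C1%:R + C2%:R <= e / 2 * n%:R :> R.
  rewrite mulrC -ler_pdivrMr ?divr_gt0//; near: n; exact: nbhs_infty_ger.
have := U1 n; have := V1 n; rewrite visits_setC => V2 U2.
have kn : k.+1%:R^-1 * n%:R <= e / 2 * n%:R by rewrite ler_pM2r.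
have C10 : 0 <= C1%:R :> R by []. have C20 : 0 <= C2%:R :> R by [].
rewrite -(ler_pM2r n0) -[X in _ * X <= _](gtr0_norm n0) -normrM mulrBl divfK ?gt_eqF//.
move: (_^-1) (visits _ _ _) U2 V2 kn => x v U2 V2 kn.
rewrite ler_norml; apply/andP; split; lra.
Unshelve. all: by end_near. Qed.

End frequency.

(** * Control functions and dyadic averages *)

Section control_functions.
Context (R : realType).
Implicit Types (v g h : R -> R) (a b : R).

(* [v b] is only constrained by monotonicity, since g may jump at b. *)
Definition controls v g a b :=
  (forall x y, a <= x -> x <= y -> y <= b -> v x <= v y) /\
  (forall x y, a <= x -> x <= y -> y < b -> `|g x - g y| <= v y - v x).

(** The witness is the total variation of g on [a, x] for x < b, extended at b by the bound C, which
    dominates all earlier values. *)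
Lemma variation_co_controlled g a b (C : R) : a < b ->
  (variation_co g a b < C%:E)%E -> exists v, controls v g a b /\ v b - v a <= C.
Proof.
move=> ab gC.
have TVC x : a <= x -> x < b -> (total_variation a x g <= C%:E)%E.
  move=> ax xb; apply/ltW/(le_lt_trans _ gC); apply: ge_ereal_sup.
  move=> _ [_ [s sp <-] <-]; apply: ereal_sup_ubound.
  by exists a, x, s; split.
have TVfin x : a <= x -> x < b -> total_variation a x g \is a fin_num.
  move=> ax xb; rewrite ge0_fin_numE ?total_variation_ge0//.
  by rewrite (le_lt_trans (TVC _ ax xb))// ltry.
pose v x := if x < b then fine (total_variation a x g) else C.
have vD x y : a <= x -> x <= y -> y < b ->
    v y - v x = fine (total_variation x y g) /\ total_variation x y g \is a fin_num.
  move=> ax xy yb; have xb := le_lt_trans xy yb; have ay := le_trans ax xy.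
  rewrite /v xb yb; have := TVfin _ ay yb; rewrite (total_variationD g ax xy).
  rewrite fin_numD => /andP[f1 f2]; split => //.
  by rewrite fineD// addrAC subrr add0r.
exists v; split; first split.
- move=> x y ax xy; rewrite le_eqVlt => /predU1P[->|yb].
    rewrite /v ltxx; case: ifPn => // xb.
    by rewrite -lee_fin fineK ?TVC// TVfin.
  have [vE f] := vD x y ax xy yb; rewrite -subr_ge0 vE.
  by rewrite fine_ge0// total_variation_ge0.
- move=> x y ax xy yb; have [-> f] := vD x y ax xy yb.
  by rewrite -lee_fin fineK// distrC total_variation_ge.
- by rewrite /v ltxx ab total_variationxx subr0.
Qed.

(** Each increment of h is at most that of v, and v is monotone on [a, b[ by the first hypothesis,
    so its increments telescope. *)
Lemma variation_co_le h v a b (C : R) :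
  (forall x y, a <= x -> x <= y -> y < b -> `|h x - h y| <= v y - v x) ->
  (forall x y, a <= x -> x <= y -> y < b -> v y - v x <= C) ->
  (variation_co h a b <= C%:E)%E.
Proof.
move=> hv vC; apply: ge_ereal_sup => _ [c [d [s [ac scd db ->]]]].
have cd := itv_partition_le scd.
rewrite lee_fin (le_trans _ (vC _ _ ac cd db))//.
have <- : variation c d v s = v d - v c.
  apply: nondecreasing_variation => // x y.
  rewrite !in_itv/= => /andP[cx _] /andP[_ yd] xy.
  rewrite -subr_ge0; apply: le_trans (hv x y _ xy _) => //.
    exact: le_trans cx.
  exact: le_lt_trans db.
apply: ler_sum_nat => n /= ns; rewrite distrC.
apply: le_trans (ler_norm _); apply: hv.
- by rewrite (le_trans ac)// (itv_partition_nth_ge _ scd)// ltnW.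
- have [/(pathP d) p _] := scd; exact/ltW/p.
- by apply: le_lt_trans db; exact: (itv_partition_nth_le (m := n.+1) _ scd).
Qed.

End control_functions.

(** * Dyadic cells and averages over them *)

Section dyadic_cells.
Context (R : realType).
Local Notation mu := (@lebesgue_measure R).

Definition dyadic (k : nat) (j : int) : R := j%:~R * 2 ^- k.

Definition cell_index (k : nat) (x : R) : int := Num.floor (x * 2 ^+ k).

Lemma pow2_gt0 k : 0 < 2 ^+ k :> R.
Proof. by rewrite exprn_gt0. Qed.

Lemma le_dyadic k i j : (i <= j)%R -> dyadic k i <= dyadic k j.
Proof. by move=> ij; rewrite ler_pM2r ?invr_gt0 ?pow2_gt0// ler_int. Qed.

Lemma dyadic_cellE k j : dyadic_cell k j = `[dyadic k j, dyadic k (j + 1)[%classic.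
Proof. by []. Qed.

Lemma dyadicS k j : dyadic k (j + 1) = dyadic k j + 2 ^- k.
Proof. by rewrite /dyadic rmorphD/= mulrDl mul1r. Qed.

Lemma mem_dyadic_cell k j x : dyadic_cell k j x <-> cell_index k x = j.
Proof.
rewrite dyadic_cellE /= in_itv/= /dyadic ler_pdivrMr ?pow2_gt0// ltr_pdivlMr ?pow2_gt0//.
rewrite -floor_eq; split; [by move/eqP|by move/eqP].
Qed.

Lemma dyadic_cell_at_index k (x : R) : dyadic_cell_at k x = dyadic_cell k (cell_index k x).
Proof.
apply/seteqP; split => y.
  by move=> [j /= /mem_dyadic_cell <-].
by move=> yx; exists (cell_index k x) => //; exact/mem_dyadic_cell.
Qed.

Lemma measurable_dyadic_cell k j : measurable (dyadic_cell k j : set R).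
Proof. exact: measurable_itv. Qed.

Lemma lebesgue_dyadic_cell k j : mu (dyadic_cell k j) = (2 ^- k)%:E.
Proof.
rewrite dyadic_cellE lebesgue_measure_itv/= lte_fin dyadicS ltrDl invr_gt0 pow2_gt0.
by rewrite -EFinD addrAC subrr add0r.
Qed.

(** Scaling by 2^(k-m) turns membership in a cell of level m into integer inequalities on the index
    of level k. *)
Lemma cell_index_refine (m k : nat) (x y : R) : (m <= k)%N ->
  cell_index k x = cell_index k y -> cell_index m x = cell_index m y.
Proof.
move=> mk xy; set j := cell_index m y.
have E z : z * 2 ^+ k = z * 2 ^+ m * (2 ^ (k - m))%N%:Z%:~R :> R.
  by rewrite -pmulrn natrX -mulrA -exprD subnKC.
have p0 : 0 < (2 ^ (k - m))%N%:Z%:~R :> R by rewrite -pmulrn natrX pow2_gt0.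
have H z : cell_index m z = j <->
    (j * (2 ^ (k - m))%N%:Z <= cell_index k z < (j + 1) * (2 ^ (k - m))%N%:Z)%R.
  rewrite /cell_index floor_ge_int floor_lt_int !intrM E ler_pM2r// ltr_pM2r//.
  by rewrite -floor_eq; split => /eqP.
by apply/H; rewrite xy; apply/H.
Qed.

Lemma cell_index_bounds (k i : nat) (x : R) :
  (- i%:R <= x < i%:R) =
  (- (i * 2 ^ k)%N%:Z <= cell_index k x < (i * 2 ^ k)%N%:Z)%R.
Proof.
rewrite /cell_index floor_ge_int floor_lt_int rmorphN/= -pmulrn natrM natrX -mulNr.
by rewrite ler_pM2r ?ltr_pM2r ?pow2_gt0.
Qed.

Lemma dyadic_nat (k i : nat) : dyadic k (i * 2 ^ k)%N%:Z = i%:R.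
Proof. by rewrite /dyadic -pmulrn natrM natrX mulfK// gt_eqF// pow2_gt0. Qed.

Lemma dyadicN (k : nat) j : dyadic k (- j) = - dyadic k j.
Proof. by rewrite /dyadic rmorphN/= mulNr. Qed.

(** On the cell, g is bounded, hence integrable, and its integral lies between those of the
    constants c - D and c + D. *)
Lemma average_close (g : R -> R) k j (c D : R) : measurable_fun setT g ->
  (forall x, dyadic_cell k j x -> `|g x - c| <= D) ->
  `|2 ^+ k * (\int[mu]_(x in dyadic_cell k j) g x) - c| <= D.
Proof.
move=> mg gD; set A := dyadic_cell k j in gD *.
have mA : measurable A by exact: measurable_dyadic_cell.
have muA : mu A = (2 ^- k)%:E by exact: lebesgue_dyadic_cell.
have ibd (h : R -> R) : measurable_fun setT h -> [bounded h x | x in A] ->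
    mu.-integrable A (EFin \o h).
  move=> mh bh; apply: measurable_bounded_integrable => //.
    by rewrite [ltLHS]muA ltry.
  exact: measurable_funTS.
have ig : mu.-integrable A (EFin \o g).
  apply: ibd => //; exists (`|c| + D); split; first exact: num_real.
  move=> M cM x Ax /=; rewrite (le_trans _ (ltW cM))//.
  by rewrite -[g x](subrK c) (le_trans (ler_normD _ _))// addrC lerD2l gD.
have icst r : mu.-integrable A (EFin \o cst r).
  apply: ibd => //; exists `|r|; split; first exact: num_real.
  by move=> M cM x Ax /=; rewrite (ltW cM).
have k0 := pow2_gt0 k.
have lo : (c - D) * 2 ^- k <= \int[mu]_(x in A) g x.
  have <- : \int[mu]_(x in A) (cst (c - D) x) = (c - D) * 2 ^- k.
    by rewrite Rintegral_cst// [X in fine X]muA.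
  apply: le_Rintegral => // x Ax; have := gD x Ax; rewrite ler_norml/=; lra.
have hi : \int[mu]_(x in A) g x <= (c + D) * 2 ^- k.
  have <- : \int[mu]_(x in A) (cst (c + D) x) = (c + D) * 2 ^- k.
    by rewrite Rintegral_cst// [X in fine X]muA.
  apply: le_Rintegral => // x Ax; have := gD x Ax; rewrite ler_norml/=; lra.
move: lo hi; rewrite ler_pdivrMr// ler_pdivlMr//; move: (Rintegral _ _ _) => r lo hi.
by rewrite ler_norml mulrC; apply/andP; split; lra.
Qed.

End dyadic_cells.

(** * Averages of controlled functions *)

Section controlled_averages.
Context (R : realType).
Local Notation mu := (@lebesgue_measure R).
Variables (g v : R -> R) (a b : R).
Hypotheses (mg : measurable_fun [set: R] g) (gv : controls v g a b).

Lemma controls_osc x y s t : a <= s -> t <= b ->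
  s <= x < t -> s <= y < t -> `|g x - g y| <= v t - v s.
Proof.
case: gv => vmon vg as_ tb.
wlog xy : x y / x <= y.
  move=> W xs ys; have [xy|/ltW yx] := leP x y; first exact: W.
  by rewrite distrC; exact: W.
move=> /andP[sx xt] /andP[sy yt].
have := vg x y (le_trans as_ sx) xy (lt_le_trans yt tb).
(* If t = b, v need not control g at t, but its monotonicity still reaches b. *)
have := vmon y t (le_trans as_ sy) (ltW yt) tb.
have := vmon s x as_ sx (le_trans (ltW xt) tb).
lra.
Qed.

Lemma controlled_average k j x : a <= dyadic R k j -> dyadic R k (j + 1) <= b ->
  dyadic_cell k j x ->
  `|2 ^+ k * (\int[mu]_(y in dyadic_cell k j) g y) - g x| <=
  v (dyadic R k (j + 1)) - v (dyadic R k j).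
Proof.
move=> aj jb jx; apply: average_close => // y jy.
exact: controls_osc.
Qed.

Lemma controlled_averages k i j : a <= dyadic R k i -> dyadic R k (j + 1) <= b -> (i < j)%R ->
  `|2 ^+ k * (\int[mu]_(y in dyadic_cell k i) g y) -
    2 ^+ k * (\int[mu]_(y in dyadic_cell k j) g y)| <=
  v (dyadic R k (j + 1)) - v (dyadic R k i).
Proof.
move=> ai jb ij; have ij1 : (i + 1 <= j)%R by rewrite lezD1.
have le_ij := le_dyadic R k ij1.
have lei := le_dyadic R k (_ : i <= i + 1)%R.
have lej := le_dyadic R k (_ : j <= j + 1)%R.
(* One average is replaced by a point value at a time; both points lie between the outer ends of the
   two cells. *)
apply: average_close => // x ix; rewrite distrC; apply: average_close => // y jy.
apply: controls_osc => //.
  move: jy; rewrite dyadic_cellE/= in_itv/= => /andP[jy ->]; rewrite andbT.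
  by rewrite (le_trans _ jy)// (le_trans _ le_ij)// lei// lerDl.
move: ix; rewrite dyadic_cellE/= in_itv/= => /andP[-> xi] /=.
by rewrite (lt_le_trans xi)// (le_trans le_ij)// lej// lerDl.
Qed.

End controlled_averages.

(** * Histograms *)

Section histograms.
Context (R : realType).
Implicit Types (u : nat -> R).
Local Notation mu := (@lebesgue_measure R).
Local Notation hist u n k := (histogram k (fun i : 'I_n => u i)).

Lemma histogramE u n k x :
  hist u n k x = 2 ^+ k * (visits (dyadic_cell k (cell_index k x)) u n / n%:R).
Proof.
by rewrite /histogram dyadic_cell_at_index -/(visits _ u n) [X in _ = _ * X]mulrC mulrA.
Qed.

(** Sharing a cell is a symmetric relation, so the histogram is a finite combination of indicators
    of fixed cells in the variable x. *)
Lemma histogram_sumE u n k x :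
  hist u n k x = \sum_(i < n) 2 ^+ k / n%:R * \1_(dyadic_cell k (cell_index k (u i))) x.
Proof.
rewrite /histogram dyadic_cell_at_index mulr_sumr; apply: eq_bigr => i _.
congr (_ * _); rewrite !indicE; congr (_%:R); congr nat_of_bool.
by apply/idP/idP; rewrite !inE => /mem_dyadic_cell xu; apply/mem_dyadic_cell.
Qed.

Lemma histogram_ge0 u n k x : 0 <= hist u n k x.
Proof. by rewrite histogramE mulr_ge0 ?exprn_ge0// divr_ge0// visits_ge0. Qed.

Lemma measurable_histogram u n k : measurable_fun [set: R] (hist u n k).
Proof.
rewrite (_ : hist u n k = fun x =>
   \sum_(i < n) 2 ^+ k / n%:R * \1_(dyadic_cell k (cell_index k (u i))) x).
  apply: measurable_sum => i; apply: measurable_funM => //.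
  by apply: measurable_indic; exact: measurable_dyadic_cell.
by apply/funext => x; rewrite histogram_sumE.
Qed.

Lemma integral_histogram u n k (A : set R) : measurable A ->
  (\int[mu]_(x in A) (hist u n k x)%:E =
   \sum_(i < n) (2 ^+ k / n%:R)%:E * mu (dyadic_cell k (cell_index k (u i)) `&` A))%E.
Proof.
move=> mA.
have mc i : measurable (dyadic_cell k (cell_index k (u i)) : set R).
  exact: measurable_dyadic_cell.
have mI i : measurable_fun A (EFin \o (\1_(dyadic_cell k (cell_index k (u i))) : R -> R)).
  by apply/measurable_EFinP; exact: measurable_indic.
have c0 : 0 <= 2 ^+ k / n%:R :> R by rewrite divr_ge0// exprn_ge0.
transitivity (\int[mu]_(x in A) \sum_(i < n) (2 ^+ k / n%:R)%:E *
    (\1_(dyadic_cell k (cell_index k (u i))) x)%:E)%E.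
  by apply: eq_integral => x _; rewrite histogram_sumE -sumEFin.
rewrite ge0_integral_sum//; last by move=> i; apply: measurable_funeM; exact: mI.
apply: eq_bigr => i _; rewrite ge0_integralZl//; last exact: mI.
by congr (_ * _)%E; rewrite integral_indic; [|exact: mA|exact: mc].
Qed.

Lemma integral_histogramT u n k : (0 < n)%N -> (\int[mu]_x (hist u n k x)%:E = 1)%E.
Proof.
move=> n0; rewrite integral_histogram//.
rewrite (eq_bigr (fun=> (n%:R^-1)%:E)).
  by rewrite sumEFin sumr_const card_ord -[X in X%:E]mulr_natl divff// pnatr_eq0 -lt0n.
by move=> i _; rewrite setIT [X in (_ * X)%E]lebesgue_dyadic_cell -EFinM mulrAC divff ?mul1r//.
Qed.

(** A cell of level k lies inside a cell of level m or misses it, so refining a histogram does not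
    change its masses on coarser cells. This allows a fixed m to serve all larger, sample-dependent
    levels. *)
Lemma Rintegral_histogram u n m k j : (m <= k)%N ->
  \int[mu]_(x in dyadic_cell m j) hist u n k x = visits (dyadic_cell m j) u n / n%:R.
Proof.
move=> mk; rewrite /Rintegral integral_histogram; last exact: measurable_dyadic_cell.
rewrite /visits mulr_suml.
rewrite (eq_bigr (fun i : 'I_n => (\1_(dyadic_cell m j) (u i) / n%:R)%:E)).
  by rewrite sumEFin.
move=> i _; set c := dyadic_cell k _.
have cu x : c x -> cell_index m x = cell_index m (u i).
  by move=> /mem_dyadic_cell cx; exact: (cell_index_refine mk).
have [uj|nuj] := pselect (dyadic_cell m j (u i)).
  have -> : c `&` dyadic_cell m j = c.
    apply/setIidl => x /cu xu; apply/mem_dyadic_cell; rewrite xu; exact/mem_dyadic_cell.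
  rewrite [X in (_ * X)%E]lebesgue_dyadic_cell -EFinM mulrAC divff ?mul1r//.
  by rewrite indicE mem_set// mul1r.
have -> : c `&` dyadic_cell m j = set0.
  apply/seteqP; split => // x [/cu xu /mem_dyadic_cell xj].
  by apply: nuj; apply/mem_dyadic_cell; rewrite -xu.
by rewrite measure0 mule0 indicE memNset ?mul0r.
Qed.

(** With K = i * 2^k, the cells of the window [-i, i[ are numbered by l < K + K, the integer index
    being l - K. *)
Lemma telescope_dyadic (v : R -> R) (k K : nat) :
  \sum_(l < K + K) (v (dyadic R k (l%:Z - K%:Z + 1)) - v (dyadic R k (l%:Z - K%:Z))) =
  v (dyadic R k K%:Z) - v (dyadic R k (- K%:Z)).
Proof.
have := telescope_sumr (fun l => v (dyadic R k (l%:Z - K%:Z))) (leq0n (K + K)).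
rewrite big_mkord PoszD addrK sub0r => <-.
by apply: eq_bigr => l _; rewrite -addn1 PoszD addrAC.
Qed.

Lemma cell_index_ord (k i : nat) (x : R) : - i%:R <= x < i%:R ->
  exists l : 'I_(i * 2 ^ k + i * 2 ^ k), cell_index k x = l%:Z - (i * 2 ^ k)%N%:Z.
Proof.
rewrite (cell_index_bounds k); set K := (i * 2 ^ k)%N; move: (cell_index _ _) => j /andP[Kj jK].
have jK0 : 0 <= j + K%:Z by rewrite -lerBlDr sub0r.
have lK : (absz (j + K%:Z)%R < K + K)%N by rewrite -ltz_nat gez0_abs// PoszD ltrD2r.
by exists (Ordinal lK); rewrite /= gez0_abs// addrK.
Qed.

Lemma cell_ord_bounds (k i : nat) (l : 'I_(i * 2 ^ k + i * 2 ^ k)) :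
  - i%:R <= dyadic R k (l%:Z - (i * 2 ^ k)%N%:Z) /\
  dyadic R k (l%:Z - (i * 2 ^ k)%N%:Z + 1) <= i%:R.
Proof.
rewrite -(dyadic_nat R k i) -dyadicN; split; apply: le_dyadic.
  by rewrite lerDr.
by rewrite addrAC lerBlDr -PoszD lez_nat addn1.
Qed.

(** Half-open with integer ends, hence a disjoint union of cells at every level. *)
Definition window (i : nat) : set R := `[- i%:R, i%:R[%classic.

Lemma measurable_window i : measurable (window i).
Proof. exact: measurable_itv. Qed.

Lemma windowP i x : window i x <-> - i%:R <= x < i%:R.
Proof. by rewrite /window /= in_itv. Qed.

Lemma L1_dist_le (g1 g2 v1 v2 : R -> R) (i m : nat) (C1 C2 : R) :
  measurable_fun [set: R] g1 -> measurable_fun [set: R] g2 ->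
  controls v1 g1 (- i%:R) i%:R -> controls v2 g2 (- i%:R) i%:R ->
  v1 i%:R - v1 (- i%:R) <= C1 -> v2 i%:R - v2 (- i%:R) <= C2 ->
  (\int[mu]_(x in window i) `|g1 x - g2 x|%:E <=
   (\sum_(l < i * 2 ^ m + i * 2 ^ m)
      `|\int[mu]_(x in dyadic_cell m (l%:Z - (i * 2 ^ m)%N%:Z)) g1 x -
        \int[mu]_(x in dyadic_cell m (l%:Z - (i * 2 ^ m)%N%:Z)) g2 x| +
    2 ^- m * (C1 + C2))%:E)%E.
Proof.
move=> mg1 mg2 vg1 vg2 vC1 vC2; set K := (i * 2 ^ m)%N.
pose c (l : 'I_(K + K)) := l%:Z - K%:Z.
pose A l : set R := dyadic_cell m (c l).
pose w v l : R := v (dyadic R m (c l + 1)) - v (dyadic R m (c l)).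
pose D l := `|\int[mu]_(x in A l) g1 x - \int[mu]_(x in A l) g2 x|.
(* Pointwise bound on cell l: the difference of the two averages plus the deviation of each function
   from its average. *)
pose S l := 2 ^+ m * D l + (w v1 l + w v2 l).
have m0 := pow2_gt0 R m.
have w0 v g l : controls v g (- i%:R) i%:R -> 0 <= w v l.
  move=> [vmon _]; have [lb ub] := cell_ord_bounds l.
  by rewrite subr_ge0; apply: vmon => //; apply: le_dyadic; rewrite lerDl.
have S0 l : 0 <= S l.
  apply: addr_ge0; first exact: mulr_ge0 (ltW m0) (normr_ge0 _).
  by apply: addr_ge0; [exact: w0 vg1|exact: w0 vg2].
have gS l x : A l x -> `|g1 x - g2 x| <= S l.
  move=> lx; have [lb ub] := cell_ord_bounds l.
  have h1 := controlled_average mg1 vg1 lb ub lx.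
  have h2 := controlled_average mg2 vg2 lb ub lx.
  rewrite -/(A l) -/(w _ _) in h1 h2.
  have -> : g1 x - g2 x = 2 ^+ m * (\int[mu]_(x in A l) g1 x - \int[mu]_(x in A l) g2 x) +
     (- (2 ^+ m * (\int[mu]_(x in A l) g1 x) - g1 x) +
     (2 ^+ m * (\int[mu]_(x in A l) g2 x) - g2 x)) by ring.
  rewrite (le_trans (ler_normD _ _))// lerD//.
    by rewrite normrM gtr0_norm.
  by rewrite (le_trans (ler_normD _ _))// lerD// ?normrN//.
(* The claimed bound is the integral of the step function with values [S l], plus a nonnegative
   slack since C1 and C2 are only upper bounds. *)
have -> : (\sum_l D l + 2 ^- m * (C1 + C2))%:E =
  (\sum_l (S l)%:E * mu (A l) +
   (2 ^- m * ((C1 - (v1 i%:R - v1 (- i%:R))) + (C2 - (v2 i%:R - v2 (- i%:R)))))%:E)%E.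
  rewrite (eq_bigr (fun l => (D l + 2 ^- m * (w v1 l + w v2 l))%:E)); last first.
    move=> l _; rewrite [X in (_ * X)%E]lebesgue_dyadic_cell -EFinM; congr (_%:E).
    by rewrite /S mulrDl mulrAC divff ?mul1r ?gt_eqF// [X in _ + X]mulrC.
  rewrite sumEFin -EFinD big_split/= -mulr_sumr big_split/= !telescope_dyadic.
  rewrite dyadicN dyadic_nat; congr (_%:E); ring.
apply: (@le_trans _ _ (\sum_l (S l)%:E * mu (A l))%E); last first.
  by rewrite leeDl// lee_fin mulr_ge0 ?invr_ge0 ?(ltW m0)// addr_ge0// subr_ge0.
have mA l : measurable (A l) by exact: measurable_dyadic_cell.
have mI l : measurable_fun [set: R] (EFin \o (\1_(A l) : R -> R)).
  by apply/measurable_EFinP; exact: measurable_indic.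
have -> : (\sum_l (S l)%:E * mu (A l) = \int[mu]_x \sum_l ((S l)%:E * (\1_(A l) x)%:E))%E.
  rewrite ge0_integral_sum//; last 2 first.
  - by move=> l; apply: measurable_funeM; exact: mI.
  - by move=> l x _; rewrite mule_ge0// lee_fin.
  apply: eq_bigr => l _; rewrite ge0_integralZl//; last 2 first.
  - exact: mI.
  - by rewrite lee_fin.
  by congr (_ * _)%E; rewrite integral_indic; [rewrite setIT| |exact: mA].
have mS : measurable_fun [set: R] (fun x => \sum_l ((S l)%:E * (\1_(A l) x)%:E))%E.
  by apply: emeasurable_sum => l; apply: measurable_funeM; exact: mI.
have Sx0 x : (0 <= \sum_l ((S l)%:E * (\1_(A l) x)%:E))%E.
  by apply: sume_ge0 => l _; rewrite mule_ge0// lee_fin.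
apply: (@le_trans _ _ (\int[mu]_(x in window i) \sum_l ((S l)%:E * (\1_(A l) x)%:E))%E).
  apply: ge0_le_integral => //.
  - exact: measurable_window.
  - apply/measurable_EFinP; apply: measurable_funTS; apply: measurableT_comp => //.
    exact: measurable_funB.
  - exact: measurable_funTS.
  - move=> x /windowP /(cell_index_ord m)[l xl].
    have lx : A l x by apply/mem_dyadic_cell.
    rewrite (bigD1 l)//= indicE mem_set// mule1.
    rewrite (@le_trans _ _ (S l)%:E) ?lee_fin ?gS// leeDl//.
    by apply: sume_ge0 => l' _; rewrite mule_ge0// lee_fin.
by apply: ge0_subset_integral => //; exact: measurable_window.
Qed.

End histograms.

(** * Convergence of the density estimate *)

Lemma histogram_level_admissible (R : realType) (alpha : nat -> R) (b n : nat)
    (xs : 'I_n -> R) :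
  histogram_level alpha b xs = 0%N \/
  admissible_level alpha xs (histogram_level alpha b xs).
Proof.
rewrite /histogram_level; elim/big_ind: _ => [|x y xP yP|k /asboolP]; [by left| |by right].
by have [_|_] := leqP x y.
Qed.

Lemma leq_histogram_level (R : realType) (alpha : nat -> R) (b n : nat)
    (xs : 'I_n -> R) k : (1 <= k <= b)%N -> admissible_level alpha xs k ->
  (k <= histogram_level alpha b xs)%N.
Proof.
move=> kb ak; apply: (bigmaxn_sup_seq k) => //; last exact/asboolP.
by rewrite mem_index_iota ltnS.
Qed.

(** * Tails and L1 distances of densities *)

Section densities.
Context (R : realType).
Local Notation mu := (@lebesgue_measure R).

Lemma integral_split (E : set R) (h : R -> R) : measurable E ->
  measurable_fun [set: R] h -> (forall x, 0 <= h x) ->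
  (\int[mu]_x (h x)%:E = \int[mu]_(x in E) (h x)%:E + \int[mu]_(x in ~` E) (h x)%:E)%E.
Proof.
move=> mE mh h0; rewrite -ge0_integral_setU.
- by rewrite setUv.
- exact: mE.
- exact: measurableC.
- by rewrite setUv; apply/measurable_EFinP.
- by move=> x _; rewrite lee_fin.
- by apply/disj_setPS; rewrite setICr.
Qed.

(** The windows increase to the whole line, so by monotone convergence their masses tend to 1. *)
Lemma density_tail (f : R -> R) (e : R) : is_density f -> 0 < e ->
  exists i, (1 <= i)%N /\ (\int[mu]_(x in ~` @window R i) (f x)%:E <= e%:E)%E.
Proof.
move=> [mf f0 f1] e0.
have mEf : measurable_fun [set: R] (EFin \o f) by apply/measurable_EFinP.
have cov : \bigcup_i @window R i = setT.
  apply/seteqP; split => // x _; exists (Num.bound `|x|) => //.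
  have := archi_boundP (normr_ge0 x); rewrite ltr_norml => /andP[lx xl].
  by apply/windowP; rewrite (ltW lx).
have : (\int[mu]_(x in @window R i) (EFin \o f) x)%E @[i --> \oo] --> (1%:E : \bar R).
  rewrite -f1 -cov; apply: ge0_nondecreasing_set_cvg_integral.
  - move=> m n mn; apply/subsetPset => x /windowP /andP[mx xm]; apply/windowP.
    by rewrite (le_trans _ mx) ?(lt_le_trans xm) ?lerN2 ?ler_nat.
  - exact: measurable_window.
  - by move=> i; exact: measurable_funTS.
  - by move=> i x _; rewrite /= lee_fin.
move=> /fine_cvgP[fin_int /cvgrPdist_le/(_ e e0) close].
near \oo => i; exists i; split; first by near: i; exact: nbhs_infty_ge.
have : `|1 - fine (\int[mu]_(x in @window R i) (f x)%:E)| <= e by near: i.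
have : (\int[mu]_(x in @window R i) (f x)%:E)%E \is a fin_num by near: i.
have := integral_split (measurable_window i) mf f0; rewrite f1.
have : (0 <= \int[mu]_(x in ~` @window R i) (f x)%:E)%E.
  by apply: integral_ge0 => x _; rewrite lee_fin.
case: (integral _ _ _) => [c||]//; case: (integral _ _ _) => [a||]//=.
rewrite -EFinD !lee_fin => _ [ac] _; rewrite ac; apply: le_trans.
by rewrite addrAC subrr add0r ler_norm.
Unshelve. all: by end_near. Qed.

(** As both total masses are 1, the mass of g outside E exceeds that of f by at most the distance
    inside E. *)
Lemma L1_dist_tail (g f : R -> R) (E : set R) : measurable E ->
  is_density g -> is_density f ->
  (\int[mu]_x `|g x - f x|%:E <=
   2%:E * (\int[mu]_(x in E) `|g x - f x|%:E + \int[mu]_(x in ~` E) (f x)%:E))%E.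
Proof.
move=> mE [mg g0 g1] [mf f0 f1].
have mC : measurable (~` E) by exact: measurableC.
have mD : measurable_fun [set: R] (fun x => `|g x - f x|).
  by apply: measurableT_comp => //; exact: measurable_funB.
have add_int (A : set R) (h1 h2 : R -> R) : measurable A ->
    measurable_fun [set: R] h1 -> measurable_fun [set: R] h2 ->
    (forall x, 0 <= h1 x) -> (forall x, 0 <= h2 x) ->
    (\int[mu]_(x in A) (h1 x + h2 x)%:E =
     \int[mu]_(x in A) (h1 x)%:E + \int[mu]_(x in A) (h2 x)%:E)%E.
  move=> mA mh1 mh2 h10 h20; rewrite -ge0_integralD//.
  - by move=> x _; rewrite lee_fin.
  - by apply/measurable_EFinP; exact: measurable_funTS.
  - by move=> x _; rewrite lee_fin.
  - by apply/measurable_EFinP; exact: measurable_funTS.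
have le_int (A : set R) (h1 h2 : R -> R) : measurable A ->
    measurable_fun [set: R] h1 -> measurable_fun [set: R] h2 ->
    (forall x, 0 <= h1 x) -> (forall x, h1 x <= h2 x) ->
    (\int[mu]_(x in A) (h1 x)%:E <= \int[mu]_(x in A) (h2 x)%:E)%E.
  move=> mA mh1 mh2 h10 h12; apply: ge0_le_integral => //.
  - by move=> x _; rewrite lee_fin.
  - by apply/measurable_EFinP; exact: measurable_funTS.
  - by apply/measurable_EFinP; exact: measurable_funTS.
  - by move=> x _; rewrite lee_fin.
have D0 x : 0 <= `|g x - f x| by [].
have ge0 (A : set R) (h : R -> R) : (forall x, 0 <= h x) -> (0 <= \int[mu]_(x in A) (h x)%:E)%E.
  by move=> h0; apply: integral_ge0 => x _; rewrite lee_fin.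
have outside : (\int[mu]_(x in ~` E) `|g x - f x|%:E <=
    \int[mu]_(x in ~` E) (g x)%:E + \int[mu]_(x in ~` E) (f x)%:E)%E.
  rewrite -add_int//; apply: le_int => //; first exact: measurable_funD.
  by move=> x; rewrite (le_trans (ler_normB _ _))// !ger0_norm.
have inside : (\int[mu]_(x in E) (f x)%:E <=
    \int[mu]_(x in E) (g x)%:E + \int[mu]_(x in E) `|g x - f x|%:E)%E.
  rewrite -add_int//; apply: le_int => //; first exact: measurable_funD.
  by move=> x; rewrite -lerBlDl distrC ler_norm.
move: g1 f1 outside inside (ge0 E _ g0) (ge0 (~` E) _ g0) (ge0 E _ f0) (ge0 (~` E) _ f0)
  (ge0 E _ D0) (ge0 (~` E) _ D0).
rewrite (integral_split mE mg g0) (integral_split mE mf f0) (integral_split mE mD D0).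
move: (\int[mu]_(x in E) (g x)%:E)%E (\int[mu]_(x in ~` E) (g x)%:E)%E
  (\int[mu]_(x in E) (f x)%:E)%E (\int[mu]_(x in ~` E) (f x)%:E)%E
  (\int[mu]_(x in E) `|g x - f x|%:E)%E (\int[mu]_(x in ~` E) `|g x - f x|%:E)%E.
move=> [c||] [c'||] [a||] [a'||] [D||] [D'||] //=; rewrite -?EFinD -?EFinM ?lee_fin.
- move=> [gE] [fE]; lra.
(* The distance inside E could be infinite, but then so is the right-hand side. *)
- by rewrite mulry gtr0_sg// mul1e leey.
Qed.

End densities.

(** * Deterministic convergence along a path with the right cell frequencies *)

Section convergence.
Context (R : realType) (alpha : nat -> R) (f : R -> R) (u : nat -> R).
Local Notation mu := (@lebesgue_measure R).
Local Notation hist n k := (histogram k (fun i : 'I_n => u i)).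
Local Notation cell_of k i l := (dyadic_cell k (l%:Z - (i * 2 ^ k)%N%:Z)).
Hypotheses (alpha_gt0 : forall i : nat, (1 <= i)%N -> 0 < alpha i)
  (f_alpha : densities_of_variation alpha f)
  (frequency : forall k j, visits (dyadic_cell k j) u n / n%:R @[n --> \oo] -->
     \int[mu]_(x in dyadic_cell k j) f x).

Lemma histogram_density n k : (0 < n)%N -> is_density (hist n k).
Proof.
move=> n0; split; [exact: measurable_histogram|exact: histogram_ge0|].
exact: integral_histogramT.
Qed.

Lemma window_ends i : (1 <= i)%N -> - i%:R < i%:R :> R.
Proof. by move=> i1; rewrite gtrN// ltr0n. Qed.

Lemma frequencies_near i k (e : R) : 0 < e -> \forall n \near \oo,
  forall l : 'I_(i * 2 ^ k + i * 2 ^ k),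
    `|visits (cell_of k i l) u n / n%:R - \int[mu]_(x in cell_of k i l) f x| <= e.
Proof.
move=> e0; apply: filter_forall => l.
have /cvgrPdist_le/(_ e e0) := @frequency k (l%:Z - (i * 2 ^ k)%N%:Z).
by apply: filterS => n; rewrite distrC.
Qed.

(** Averaging f over cells costs at most 2 [alpha i]. Only finitely many cells meet the window, so
    the sampling errors eventually add at most another [alpha i]. *)
Lemma histogram_variation_near i k : (1 <= i)%N ->
  \forall n \near \oo, (variation_co (hist n k) (- i%:R) i%:R < (4 * alpha i)%:E)%E.
Proof.
move=> i1; have ai := alpha_gt0 i1; have [[mf _ _] /(_ i i1) Vf] := f_alpha.
have [v [vf vC]] := variation_co_controlled (window_ends i1) Vf.
set K := (i * 2 ^ k)%N.
have K0 : 0 < K%:R :> R by rewrite ltr0n muln_gt0 i1 expn_gt0.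
(* There are fewer than 2 K cell boundaries, each costing 2 e, so the errors total at most 4 K e =
   [alpha i]. *)
pose e := alpha i / (4 * K%:R).
have e0 : 0 < e by rewrite divr_gt0// mulr_gt0.
have eK : 4 * K%:R * e = alpha i by rewrite mulrC divfK// gt_eqF// mulr_gt0.
near=> n.
pose avg j := 2 ^+ k * \int[mu]_(x in dyadic_cell k j) f x.
have close (l : 'I_(K + K)) :
    `|2 ^+ k * (visits (cell_of k i l) u n / n%:R) - avg (l%:Z - K%:Z)| <= e.
  rewrite /avg -mulrBr normrM gtr0_norm ?pow2_gt0// mulrC -ler_pdivlMr ?pow2_gt0//.
  by move: l; near: n; apply: frequencies_near; rewrite divr_gt0 ?pow2_gt0.
(* The jump between the averages over two adjacent cells is bounded by the
   increase of v over both cells, hence the sum of v at the two ends of a cell;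
   the last term pays for the error e on either side of a cell boundary. *)
pose W (x : R) := v (dyadic R k (cell_index k x + 1)) + v (dyadic R k (cell_index k x)) +
  2 * e * (cell_index k x)%:~R.
apply: (@le_lt_trans _ _ (3 * alpha i)%:E); last by rewrite lte_fin; lra.
have [vmon _] := vf.
have idx (x y : R) : - i%:R <= x -> x <= y -> y < i%:R -> exists l1 l2 : 'I_(K + K),
    [/\ cell_index k x = l1%:Z - K%:Z, cell_index k y = l2%:Z - K%:Z & (l1 <= l2)%N].
  move=> ix xy yi.
  have [|l1 xl] := @cell_index_ord R k i x; first by rewrite ix (le_lt_trans xy).
  have [|l2 yl] := @cell_index_ord R k i y; first by rewrite (le_trans ix).
  exists l1, l2; split => //.
  have : cell_index k x <= cell_index k y by apply: le_floor; rewrite ler_pM2r ?pow2_gt0.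
  by rewrite xl yl lerD2r lez_nat.
apply: (variation_co_le (v := W)) => x y ix xy yi.
- have [l1 [l2 [xl yl]]] := idx x y ix xy yi.
  rewrite leq_eqVlt => /predU1P[l12|l12].
    by rewrite !histogramE /W xl yl l12 !subrr normr0.
  have [lb1 ub1] := cell_ord_bounds R l1; have [lb2 ub2] := cell_ord_bounds R l2.
  have j12 : (l1%:Z - K%:Z < l2%:Z - K%:Z)%R by rewrite ltrD2r ltz_nat.
  have h := controlled_averages mf vf lb1 ub2 j12.
  have c1 := close l1; have c2 := close l2.
  rewrite !histogramE /W xl yl.
  (* As the cells are distinct, the v-part of W grows at least by the increase of v from the left
     end of the first to the right end of the second. *)
  have vv : v (dyadic R k (l1%:Z - K%:Z + 1)) <= v (dyadic R k (l2%:Z - K%:Z)).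
    apply: vmon => //.
    - by apply: (le_trans lb1); apply: le_dyadic; rewrite lerDl.
    - by apply: le_dyadic; rewrite lezD1.
    - by apply: (le_trans _ ub2); apply: le_dyadic; rewrite lerDl.
  have ee : e <= e * (l2%:R - l1%:R).
    by rewrite ler_peMr ?(ltW e0)// lerBrDl natr1 ler_nat.
  rewrite !rmorphB/= -!pmulrn.
  move: h c1 c2; rewrite -/(avg _) -/(avg _) !ler_norml.
  move=> /andP[? ?] /andP[? ?] /andP[? ?].
  apply/andP; split; nra.
- have [l1 [l2 [xl yl l12]]] := idx x y ix xy yi.
  have [lb1 ub1] := cell_ord_bounds R l1; have [lb2 ub2] := cell_ord_bounds R l2.
  have lbS (l : 'I_(K + K)) : dyadic R k (l%:Z - K%:Z) <= dyadic R k (l%:Z - K%:Z + 1).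
    by apply: le_dyadic; rewrite lerDl.
  have v1 : v (dyadic R k (l2%:Z - K%:Z + 1)) <= v i%:R.
    by apply: vmon => //; exact: le_trans lb2 (lbS _).
  have v2 : v (dyadic R k (l2%:Z - K%:Z)) <= v i%:R.
    by apply: vmon => //; exact: le_trans (lbS _) ub2.
  have v3 : v (- i%:R) <= v (dyadic R k (l1%:Z - K%:Z)).
    by apply: vmon => //; exact: le_trans (lbS _) ub1.
  have v4 : v (- i%:R) <= v (dyadic R k (l1%:Z - K%:Z + 1)).
    by apply: vmon => //; exact: le_trans lb1 (lbS _).
  rewrite /W xl yl !rmorphB/= -!pmulrn.
  have l2K : (l2%:R : R) <= 2 * K%:R by rewrite mulr_natl mulr2n -natrD ler_nat ltnW.
  have l10 : 0 <= l1%:R :> R by [].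
  have : e * (l2%:R - l1%:R) <= e * (2 * K%:R) by rewrite ler_pM2l//; lra.
  lra.
Unshelve. all: by end_near. Qed.

Lemma estimate_cvg (b : nat -> nat) : b n @[n --> \oo] --> \oo ->
  (\int[mu]_x `|density_estimate alpha (b n) (fun i : 'I_n => u i) x - f x|%:E)%E
    @[n --> \oo] --> 0%E.
Proof.
move=> b_oo.
suff near_le (e : R) : 0 < e -> \forall n \near \oo,
    (\int[mu]_x `|density_estimate alpha (b n) (fun i : 'I_n => u i) x - f x|%:E <= e%:E)%E.
  have I0 n : (0 <= \int[mu]_x `|density_estimate alpha (b n) (fun i : 'I_n => u i) x - f x|%:E)%E.
    by apply: integral_ge0 => x _; rewrite lee_fin.
  apply/fine_cvgP; split.
    apply: filterS (near_le 1 ltr01) => n n1.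
    by rewrite ge0_fin_numE// (le_lt_trans n1)// ltry.
  apply/cvgrPdist_le => e e0; apply: filterS (near_le e e0) => n ne.
  rewrite sub0r normrN /= ger0_norm ?fine_ge0// -lee_fin fineK//.
  by rewrite ge0_fin_numE// (le_lt_trans ne)// ltry.
move=> e0; have [df Vf] := f_alpha; have [mf f0 _] := df.
(* Three errors of e / 6 occur: the tail of f, the oscillations inside the window and the
   differences in mean; [L1_dist_tail] doubles their sum. *)
have e6 : 0 < e / 6 by rewrite divr_gt0.
have [i [i1 tail_f]] := density_tail df e6.
have ai := alpha_gt0 i1.
have [m mE] : exists m, 2 ^- m * (4 * alpha i + alpha i) <= e / 6.
  exists (Num.bound ((4 * alpha i + alpha i) / (e / 6))).
  have c0 : 0 <= (4 * alpha i + alpha i) / (e / 6).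
    by rewrite divr_ge0// ltW// addr_gt0// mulr_gt0.
  rewrite [leLHS]mulrC ler_pdivrMr ?pow2_gt0// [leRHS]mulrC -ler_pdivrMr//.
  rewrite (le_trans (ltW (archi_boundP c0)))// -natrX ler_nat.
  by rewrite ltnW// ltn_expl.
(* Levels above m refine level m, and admissibility at a level of at least i bounds the variation on
   the window of index i. *)
pose k0 := maxn m i.
have i_k0 : (i <= k0)%N by rewrite leq_maxr.
have k01 : (1 <= k0)%N := leq_trans i1 i_k0.
(* Admissibility of the fixed level [k0] involves only finitely many windows. *)
have k0_adm : \forall n \near \oo, admissible_level alpha (fun j : 'I_n => u j) k0.
  have : \forall n \near \oo, forall l : 'I_k0,
      (variation_co (hist n k0) (- l.+1%:R) l.+1%:R < (4 * alpha l.+1)%:E)%E.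
    by apply: filter_forall => l; exact: histogram_variation_near.
  apply: filterS => n H [//|l] /andP[_ lk]; exact: (H (Ordinal lk)).
near=> n.
have n0 : (0 < n)%N by near: n; exact: nbhs_infty_gt.
have adm0 : admissible_level alpha (fun j : 'I_n => u j) k0 by near: n.
have bk : (k0 <= b n)%N by near: n; exact: (b_oo _ (nbhs_infty_ge k0)).
rewrite /density_estimate.
set k := histogram_level alpha (b n) (fun j : 'I_n => u j).
have k0k : (k0 <= k)%N by apply: leq_histogram_level => //; rewrite k01.
have k_gt0 : (0 < k)%N := leq_trans k01 k0k.
(* The level is positive, so it is not the default 0 of an empty maximum. *)
have adm : admissible_level alpha (fun j : 'I_n => u j) k.
  have [] := histogram_level_admissible alpha (b n) (fun j : 'I_n => u j) => //.
  by rewrite -/k => kE; rewrite kE in k_gt0.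
rewrite (negbTE (lt0n_neq0 k_gt0)).
have Vk : (variation_co (hist n k) (- i%:R) i%:R < (4 * alpha i)%:E)%E.
  by apply: adm; rewrite i1 (leq_trans i_k0).
have [v1 [vh v1C]] := variation_co_controlled (window_ends i1) Vk.
have [v2 [vf v2C]] := variation_co_controlled (window_ends i1) (Vf i i1).
have inside := L1_dist_le m (measurable_histogram u n k) mf vh vf v1C v2C.
apply: le_trans (L1_dist_tail (measurable_window i) (histogram_density k n0) df) _.
have inside_e : (\int[mu]_(x in @window R i) `|hist n k x - f x|%:E <= (e / 6 + e / 6)%:E)%E.
  apply: (le_trans inside); rewrite lee_fin lerD//.
  (* The error e / 6 is shared equally among the cells of level m in the window. *)
  apply: (@le_trans _ _ (\sum_(l < i * 2 ^ m + i * 2 ^ m) (e / 6) / (i * 2 ^ m + i * 2 ^ m)%:R)).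
    apply: ler_sum => l _; rewrite Rintegral_histogram; last first.
      by rewrite (leq_trans _ k0k)// leq_maxl.
    move: l; near: n; apply: frequencies_near.
    by rewrite divr_gt0// ltr0n addn_gt0 muln_gt0 i1 expn_gt0.
  rewrite sumr_const card_ord -[leLHS]mulr_natr divfK//.
  by rewrite pnatr_eq0 -lt0n addn_gt0 muln_gt0 i1 expn_gt0.
apply: (@le_trans _ _ (2%:E * ((e / 6 + e / 6)%:E + (e / 6)%:E))%E).
  by rewrite lee_wpmul2l// leeD.
rewrite -EFinD -EFinM lee_fin; lra.
Unshelve. all: by end_near. Qed.

End convergence.

(* X i stands for the (i+1)-st observation of the process. *)
Theorem corollary1 (R : realType) (alpha : nat -> R) (b : nat -> nat)
    (alpha_gt0 : forall i : nat, (1 <= i)%N -> 0 < alpha i)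
    (alpha_nd : forall i j : nat, (1 <= i <= j)%N -> alpha i <= alpha j)
    (b_gt0 : forall n : nat, (1 <= n)%N -> (0 < b n)%N)
    (b_oo : b n @[n --> \oo] --> \oo)
    (d : measure_display) (T : measurableType d) (P : probability T R)
    (X : nat -> {RV P >-> R}) (f : R -> R)
    (X_stationary : stationary X) (X_ergodic : ergodic X)
    (X_density : forall i : nat, has_density (X i) f)
    (f_alpha : densities_of_variation alpha f) :
  {ae P, forall w,
    (\int[lebesgue_measure]_x
       `|density_estimate alpha (b n) (fun i : 'I_n => X i w) x - f x|%:E)%E
      @[n --> \oo] --> 0%E}.
Proof.
have mass k j : fine (P (X 0%N @^-1` dyadic_cell k j)) =
    \int[lebesgue_measure]_(x in dyadic_cell k j) f x.
  rewrite /Rintegral -(X_density 0%N)//; exact: measurable_dyadic_cell.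
pose good k j w := visits (dyadic_cell k j) (fun i => X i w) n / n%:R @[n --> \oo] -->
  (\int[lebesgue_measure]_(x in dyadic_cell k j) f x : R).
have good_ae k j : {ae P, forall w, good k j w}.
  rewrite /good -mass; apply: visit_frequency_cvg => //.
  exact: measurable_dyadic_cell.
(* Cell indices are split by sign so that countable intersections run over natural numbers. *)
have : {ae P, forall w, forall k p, good k (Posz p) w /\ good k (Negz p) w}.
  apply: ae_foralln => k; apply: ae_foralln => p.
  exact: filterS2 (good_ae k (Posz p)) (good_ae k (Negz p)).
apply: filterS => w good_w.
apply: (estimate_cvg (u := fun i => X i w) alpha_gt0 f_alpha) => // k [] p.
  exact: (good_w k p).1.
exact: (good_w k p).2.
Qed.
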